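(* Let $p$ be an odd prime, let $s\ge0$ be an integer, let $\delta\in\{1,-1\}$, and let $r$ be an integer with $r\ge\max\{3,s+1\}$ and $p\nmid r$. Let $G$ be a group of automorphisms of the augmented Praeger–Xu graph $\mathrm{C}^*(p,r,s,\delta)$ acting regularly on its arcs. Then $G\cong\mathbb{Z}_p^{s+1}\rtimes\mathrm{D}_{2r}$.
   Context: $\mathrm{D}_{2r}$ is the dihedral group of order $2r$. For $s\ge1$, the Praeger–Xu graph $\mathrm{C}(p,r,s)$ is the simple graph with vertex set $\mathbb{Z}_r\times\mathbb{Z}_p^s$ whose edges are all pairs $\{(i,x_0,\dots,x_{s-1}),(i+1,x_1,\dots,x_s)\}$, $i\in\mathbb{Z}_r$, $x_j\in\mathbb{Z}_p$. The augmented Praeger–Xu graph $\mathrm{C}^*(p,r,s,\delta)$ is: $\mathrm{C}(p,r,s)$ if $s\ge1$; the multicycle $\mathrm{C}_r^{(p)}$ (a cycle of length $r$ in which each pair of adjacent vertices is joined by $p$ parallel edges) if $s=0,\delta=1$; the cycle $\mathrm{C}_{pr}$ if $s=0,\delta=-1$. Graphs may have multiple edges; an arc is an edge together with a direction. *)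

(* Defs.v *)
From HB Require Import structures.
From mathcomp Require Import all_boot all_order all_algebra all_fingroup all_solvable.
Set Implicit Arguments. Unset Strict Implicit. Unset Printing Implicit Defensive.

(* A (multi)graph is given by its vertices, its arcs, the tail and head of each
   arc, and the arc-reversal involution (an edge = a pair of mutually reverse
   arcs).  Parallel edges are distinct arcs. *)
Record mgraph := MGraph {
  vert : finType;
  arc : finType;
  tail : arc -> vert;
  head : arc -> vert;
  rev : arc -> arc }.

(* A simple graph given by a symmetric adjacency relation [adj]: the arcs are
   the ordered pairs (u,v) with adj u v; reversal swaps the pair. *)
Definition sg_arc (T : finType) (adj : rel T) := {x : T * T | adj x.1 x.2}.

Definition simple_mgraph (T : finType) (adj : rel T) : mgraph :=
  @MGraph T (sg_arc adj) (fun a => (val a).1) (fun a => (val a).2)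
     (fun a => insubd a ((val a).2, (val a).1)).

Definition symc (T : Type) (e : rel T) : rel T := fun u v => e u v || e v u.

(* Praeger-Xu graph C(p,r,s), s >= 1: vertex set Z_r x Z_p^s, edges
   {(i,x_0,...,x_{s-1}), (i+1,x_1,...,x_s)}. Z_r is 'I_r with ordS = +1 mod r. *)
Definition px_vert (p r s : nat) := ('I_r * {ffun 'I_s -> 'I_p})%type.

Definition px_e (p r s : nat) : rel (px_vert p r s) := fun u v =>
  [exists x : {ffun 'I_s.+1 -> 'I_p},
     [&& u.2 == [ffun j : 'I_s => x (widen_ord (leqnSn s) j)],
         v.1 == ordS u.1 &
         v.2 == [ffun j : 'I_s => x (lift ord0 j)]]].

Definition PX (p r s : nat) : mgraph := simple_mgraph (symc (@px_e p r s)).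

(* Multicycle C_r^(p): arc (i,k,false) goes i -> i+1, (i,k,true) goes i+1 -> i
   (k : 'I_p indexes the p parallel edges between i and i+1). *)
Definition multicycle (p r : nat) : mgraph :=
  @MGraph 'I_r ('I_r * 'I_p * bool)%type
    (fun a => if a.2 then ordS a.1.1 else a.1.1)
    (fun a => if a.2 then a.1.1 else ordS a.1.1)
    (fun a => (a.1, ~~ a.2)).

Definition cycle_graph (n : nat) : mgraph :=
  simple_mgraph (symc (fun u v : 'I_n => v == ordS u)).

Definition PXstar (p r s : nat) (delta : int) : mgraph :=
  if s == 0 then (if delta == 1%R then multicycle p r else cycle_graph (p * r))
  else PX p r s.

(* The automorphisms of a graph, as pairs (vertex permutation, arc permutation)
   compatible with tail, head and reversal.  The type of pairs is a
   finGroupType (external direct product, gproduct.v). *)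
Notation aut_gtype X := ({perm vert X} * {perm arc X})%type.

Definition GAut (X : mgraph) : {set aut_gtype X} :=
  [set g : aut_gtype X | [forall a : arc X,
     [&& tail (g.2 a) == g.1 (tail a),
         head (g.2 a) == g.1 (head a) &
         rev (g.2 a) == g.2 (rev a)]]].

Definition arc_regular (X : mgraph) (G : {set aut_gtype X}) : Prop :=
  forall a b : arc X, exists! g : aut_gtype X, g \in G /\ g.2 a = b.

(* Main.v *)
Require Import Defs.
From HB Require Import structures.
From mathcomp Require Import all_boot all_order all_algebra all_fingroup all_solvable.
Import Defs.
Set Implicit Arguments. Unset Strict Implicit. Unset Printing Implicit Defensive.

Local Open Scope group_scope.

(** Every arc lies over an arc of the [r]-cycle (its level).  Unless the graph is
    [C(p,4,1) = K_{2p,2p}], automorphisms respect levels, because the two sides of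
    the neighbourhood of a vertex can be told apart by counting common neighbours.  The kernel
    [K] of the action of [G] on levels is then regular on the [p ^ s.+1] arcs of a level,
    and [G / K] is generated by two reflections of the [r]-cycle, hence dihedral of order
    [2 r].  A level is a set of strings of length [s.+1] over [Z_p], and [K] permutes
    the [p] possible values of each letter; since a subgroup of index [p] of the [p]-group [K]
    contains ['Phi(K)], the Frattini subgroup fixes all letters, so [K] is elementary abelian.
    Schur-Zassenhaus provides the complement.
    For [K_{2p,2p}] the stabilisers [A] and [B] of two adjacent vertices have
    order [2 p], intersect trivially, and are swapped by an involution [t]; then [A * B] has a
    normal Sylow [p]-subgroup [P], and [G / P] is generated by [t] and an involution of [A]. *)

(** * Group theory *)

Lemma abelem_isog_rV (gT : finGroupType) (K : {group gT}) (p n : nat) :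
  prime p -> p.-abelem K -> #|K| = (p ^ n)%N -> K \isog [set: 'rV['Z_p]_n].
Proof.
move=> p_pr abK cK; have p_gt1 := prime_gt1 p_pr.
rewrite (isog_abelem_card _ abK) cK cardsT card_mx mul1n card_ord Zp_cast //.
rewrite eqxx andbT abelemE // FinRing.zmod_abelian /=.
apply/exponentP => x _; rewrite FinRing.zmodXgE; apply/matrixP => i j.
by rewrite mulmxnE !mxE -GRing.mulr_natr pchar_Zp // GRing.mulr0.
Qed.

(** The index [2 * r] of [K] is prime to [p], so [K] is a Hall subgroup and has a complement,
    isomorphic to [G / K]. Every case of the theorem ends here. *)
Lemma semidirect_of_quotient (gT : finGroupType) (G K : {group gT})
    (p s r : nat) :
  prime p -> odd p -> ~~ (p %| r)%N -> K <| G -> p.-abelem K ->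
  #|K| = (p ^ s.+1)%N -> G / K \isog 'D_(2 * r) -> #|G| = (2 * r * #|K|)%N ->
  exists N H : {group gT},
    [/\ N ><| H = G, N \isog [set: 'rV['Z_p]_(s.+1)] & H \isog 'D_(2 * r)].
Proof.
move=> p_pr p_odd npr nKG abK cK isoD cG.
have hallK : Hall G K.
  rewrite /Hall normal_sub // -divgS ?normal_sub // cG mulnK ?cardG_gt0 // cK.
  rewrite coprimeXl // prime_coprime // Euclid_dvdM // negb_or npr andbT.
  by rewrite dvdn_prime2 //; apply: contraTneq p_odd => ->.
have /splitsP [H complH] := SchurZassenhaus_split hallK nKG.
have defG : K ><| H = G.
  case/complP: complH => tiKH defG; rewrite sdprodE //.
  by apply: subset_trans (normal_norm nKG); rewrite -defG mulG_subr.
exists K, H; split=> //; first exact: abelem_isog_rV.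
exact: isog_trans (sdprod_isog defG) isoD.
Qed.

Lemma order_eq2 (gT : finGroupType) (x : gT) : x != 1 -> x ^+ 2 = 1 -> #[x] = 2.
Proof. by move=> nx x2; apply: nt_prime_order. Qed.

(** * Groups with two subgroups of order [2 * p] exchanged by an involution *)

Section TwoFactors.

Variables (gT : finGroupType) (p : nat) (G M A B : {group gT}) (t : gT).
Hypotheses (p_pr : prime p) (p_odd : odd p).
Hypotheses (sAM : A \subset M) (sBM : B \subset M) (sMG : M \subset G).
Hypotheses (cA : #|A| = (2 * p)%N) (cB : #|B| = (2 * p)%N).
Hypotheses (tiAB : A :&: B = 1) (cM : #|M| = (4 * p ^ 2)%N).
Hypotheses (cG : #|G| = (8 * p ^ 2)%N).
Hypotheses (Gt : t \in G) (t2 : t ^+ 2 = 1) (nMt : t \notin M).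
Hypothesis (AtB : A :^ t = B).

Let p_gt2 : 2 < p.
Proof. by case: p p_pr p_odd => [|[|[]]]. Qed.

Let logn2p : logn p 2 = 0.
Proof. by rewrite logn_coprime // coprimen2. Qed.

Let logn4p : logn p 4 = 0.
Proof. by rewrite (_ : 4 = 2 * 2)%N // lognM // logn2p. Qed.

Lemma card_Syl_2p (X Q : {group gT}) : #|X| = (2 * p)%N -> p.-Sylow(X) Q ->
  #|Q| = p /\ Q <| X.
Proof.
move=> cX sylQ; have cQ : #|Q| = p.
  rewrite (card_Hall sylQ) cX p_part lognM // ?(prime_gt0 p_pr) // logn2p.
  by rewrite logn_prime // eqxx expn1.
split=> //; apply: index2_normal; first exact: pHall_sub sylQ.
by rewrite -divgS ?(pHall_sub sylQ) // cX cQ mulnK // prime_gt0.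
Qed.

Lemma card_Syl_M (P : {group gT}) : p.-Sylow(M) P -> #|P| = (p ^ 2)%N.
Proof.
move=> sylP; rewrite (card_Hall sylP) cM p_part lognM ?expn_gt0 ?(prime_gt0 p_pr) //.
by rewrite logn4p pfactorK.
Qed.

(* [X] and a Sylow subgroup [P] of [M] containing [Q] both normalise [Q], so either
   [Q] is normal in [M] or ['N_M(Q)] has order [2 * p ^ 2] and normalises [P]. *)
Lemma Syl_normal_or (X Q : {group gT}) : X \subset M -> #|X| = (2 * p)%N ->
  p.-Sylow(X) Q -> Q <| M \/ exists2 P : {group gT}, p.-Sylow(M) P & P <| M.
Proof.
move=> sXM cX sylQ; have [cQ nQX] := card_Syl_2p cX sylQ.
have sQM : Q \subset M := subset_trans (normal_sub nQX) sXM.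
have [P sylP sQP] := Sylow_superset sQM (pHall_pgroup sylQ).
have cP := card_Syl_M sylP; have sPM := pHall_sub sylP.
have abP : abelian P := card_p2group_abelian p_pr cP.
set N := 'N_M(Q)%G.
have sXN : X \subset N by rewrite subsetI sXM normal_norm.
have sPN : P \subset N by rewrite subsetI sPM (sub_abelian_norm abP).
have dN : (2 * p ^ 2 %| #|N|)%N.
  rewrite Gauss_dvd; last first.
    by rewrite coprime_pexpr // coprime2n.
  by rewrite -cP cardSg // andbT (dvdn_trans _ (cardSg sXN)) // cX dvdn_mulr.
have [k cN] := dvdnP dN.
have k_dv : (k %| 2)%N.
  have := cardSg (subsetIl M 'N(Q)); rewrite -/N cN cM (_ : 4 = 2 * 2)%N //.
  by rewrite -mulnA dvdn_pmul2r // muln_gt0 expn_gt0 (prime_gt0 p_pr).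
have : (k <= 2)%N by apply: dvdn_leq.
case: k cN k_dv => [|[|[|k]]] // cN _ _; last first.
  left; rewrite /normal sQM; apply/setIidPl/eqP.
  by rewrite eqEcard subsetIl [#|_|]cM [leqRHS]cN mulnA leqnn.
right; apply/normal_sylowP.
have nPN : P <| N.
  by apply: index2_normal => //; rewrite -divgS // cN cP mul1n mulnK // expn_gt0 (prime_gt0 p_pr).
have sNN : N \subset 'N_M(P) by rewrite subsetI subsetIl normal_norm.
(* The number of Sylow subgroups divides the index 2 of [N] in [M] and is 1 modulo [p > 2], hence it
   is 1. *)
have dS : (#|'Syl_p(M)| %| 2)%N.
  rewrite (card_Syl sylP); apply: dvdn_trans (indexgS M sNN) _.
  rewrite -divgS ?subsetIl // cM cN mul1n (_ : 4 = 2 * 2)%N //.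
  by rewrite -mulnA mulnK // muln_gt0 expn_gt0 (prime_gt0 p_pr).
have mS := card_Syl_mod M p_pr.
move: dS; rewrite dvdn_divisors // !inE => /orP[]/eqP cS; first by rewrite cS.
by move: mS; rewrite cS modn_small.
Qed.

(** In the remaining alternative the Sylow subgroups of [A] and of [B] are both normal in [M]. They
    meet trivially, so their join has order [p ^ 2]. *)
Lemma two_factors_Syl : exists2 P : {group gT}, p.-Sylow(M) P & P <| M.
Proof.
have [PA sylA] := Sylow_exists p A; have [PB sylB] := Sylow_exists p B.
have [cPA _] := card_Syl_2p cA sylA; have [cPB _] := card_Syl_2p cB sylB.
have [nA|//] := Syl_normal_or sAM cA sylA.
have [nB|//] := Syl_normal_or sBM cB sylB.
have ti : PA :&: PB = 1.
  by apply/trivgP; rewrite -tiAB setISS ?(pHall_sub sylA) ?(pHall_sub sylB).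
have nPAB : PB \subset 'N(PA).
  exact: subset_trans (normal_sub nB) (normal_norm nA).
exists (PA <*> PB)%G; last exact: normalY.
have cY : #|PA <*> PB| = (p ^ 2)%N by rewrite norm_joinEr // TI_cardMg // cPA cPB.
rewrite pHallE join_subG !normal_sub //= cY.
have [P sylP] := Sylow_exists p M.
by rewrite -(card_Hall sylP) (card_Syl_M sylP).
Qed.

Lemma two_factors_dihedral : exists K : {group gT},
  [/\ K <| G, p.-abelem K, #|K| = (p ^ 2)%N & G / K \isog 'D_8].
Proof.
have [P sylP nPM] := two_factors_Syl.
have cP := card_Syl_M sylP.
have p_gt0 := prime_gt0 p_pr.
have iM : #|G : M| = 2.
  by rewrite -divgS // cG cM (_ : 8 = 2 * 4)%N // -mulnA mulnK // muln_gt0 expn_gt0 p_gt0.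
have nMG := index2_normal sMG iM.
have nPG : P <| G.
  (* [P] is the [p]-core of [M], hence characteristic in [M], which is normal in [G]. *)
  by rewrite -(normal_Hall_pcore sylP nPM); apply: gFnormal_trans.
have abP : abelian P := card_p2group_abelian p_pr cP.
have [PA sylA] := Sylow_exists p A; have [PB sylB] := Sylow_exists p B.
have [cPA _] := card_Syl_2p cA sylA; have [cPB _] := card_Syl_2p cB sylB.
have ti : PA :&: PB = 1.
  by apply/trivgP; rewrite -tiAB setISS ?(pHall_sub sylA) ?(pHall_sub sylB).
have sub (X Q : {group gT}) : X \subset M -> p.-Sylow(X) Q -> Q \subset P.
  move=> sXM sylQ; rewrite (sub_normal_Hall sylP nPM) ?(pHall_pgroup sylQ) //.
  exact: subset_trans (pHall_sub sylQ) sXM.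
have sPA := sub _ _ sAM sylA; have sPB := sub _ _ sBM sylB.
have defP : PA * PB = P.
  by apply/eqP; rewrite eqEcard mul_subG // TI_cardMg // cPA cPB cP mulnn leqnn.
have elP : p.-abelem P.
  rewrite abelemE // abP; apply/exponentP => z.
  rewrite -defP => /mulsgP[x y Px Py ->].
  rewrite expgMn; last first.
    by apply: (centsP abP); [apply: (subsetP sPA) | apply: (subsetP sPB)].
  by rewrite -{1}cPA -{1}cPB !expg_cardG // mulg1.
exists P; split=> //.
have sNP : G \subset 'N(P) := normal_norm nPG.
have [a Aa oa] : {a | a \in A & #[a] = 2} by apply: Cauchy; rewrite ?cA ?dvdn_mulr.
have Ma := subsetP sAM _ Aa; have Ga := subsetP sMG _ Ma.
have nP2 x : x \in P -> x ^+ 2 = 1 -> x = 1.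
  move=> Px x2; apply/eqP; rewrite -order_eq1 -dvdn1.
  have /eqnP <- : coprime 2 (p ^ 2) by rewrite coprime_pexpr // coprime2n.
  by rewrite dvdn_gcd order_dvdn x2 eqxx -cP order_dvdG.
have a2 : a ^+ 2 = 1 by rewrite -oa expg_order.
have nPa : a \notin P by apply/negP => /nP2 /(_ a2) a1; rewrite a1 order1 in oa.
have nPt : t \notin P by apply: contra nMt => /(subsetP (normal_sub nPM)).
have co1 x : x \in G -> x \notin P -> coset P x != 1.
  by move=> Gx; apply: contra => /eqP /coset_idr -> //; apply: (subsetP sNP).
have oca : #[coset P a] = 2.
  by apply: order_eq2; rewrite ?co1 // -morphX ?(subsetP sNP) // a2 morph1.
have oct : #[coset P t] = 2.
  by apply: order_eq2; rewrite ?co1 // -morphX ?(subsetP sNP) // t2 morph1.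
set b := a ^ t.
have Bb : b \in B by rewrite -AtB memJ_conjg.
have Mb := subsetP sBM _ Bb.
have nMP x : x \in M -> x \in 'N(P) by move=> Mx; apply: (subsetP sNP); apply: (subsetP sMG).
have cMP : #|M / P| = 4.
  rewrite card_quotient ?normal_norm // -divgS ?normal_sub // cM cP.
  by rewrite mulnK // expn_gt0 p_gt0.
(* Otherwise [Q], of order at most [2 * p ^ 2], would contain both [A] and [B], whose product has
   [4 * p ^ 2] elements. *)
have ncab : coset P a != coset P b.
  apply/eqP => eab; pose Q := (P <*> <[a]>)%G.
  have sPQ : P \subset Q := joing_subl _ _.
  have Qa : a \in Q by apply: (subsetP (joing_subr _ _)); apply: cycle_id.
  have Qb : b \in Q.
    rewrite -(mulKVg a b) groupM // (subsetP sPQ) //.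
    apply: coset_idr; first by rewrite groupM ?groupV ?nMP.
    by rewrite morphM ?groupV ?nMP // morphV ?nMP //= eab mulVg.
  have sQ (X : {group gT}) x : X \subset M -> #|X| = (2 * p)%N -> x \in X ->
      #[x] = 2 -> x \in Q -> X \subset Q.
    move=> sXM cX Xx ox Qx; apply/setIidPl/eqP; rewrite eqEcard subsetIl /=.
    apply: dvdn_leq => //; have [R sylR] := Sylow_exists p X.
    have [cR _] := card_Syl_2p cX sylR.
    rewrite cX Gauss_dvd ?coprime2n //; apply/andP; split.
      by rewrite -ox order_dvdG // inE Xx.
    rewrite -{1}cR cardSg // subsetI (pHall_sub sylR).
    exact: subset_trans (sub _ _ sXM sylR) sPQ.
  have sAQ := sQ _ _ sAM cA Aa oa Qa.
  have sBQ : B \subset Q by apply: (sQ _ b) => //; rewrite orderJ.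
  have leQ : (#|Q| <= p ^ 2 * 2)%N.
    rewrite /Q /= norm_joinEr ?cycle_subG ?nMP // -cP -oa /order mul_cardG.
    by rewrite leq_pmulr ?cardG_gt0.
  have leAB : #|(A * B)%g| <= #|Q| by rewrite subset_leq_card ?mul_subG.
  move: (leq_trans leAB leQ); rewrite TI_cardMg // cA cB mulnACA (mulnn p) mulnC.
  by rewrite leq_pmul2l // expn_gt0 p_gt0.
set D := <<[set coset P a; coset P t]>>.
have Da : coset P a \in D by rewrite mem_gen // !inE eqxx.
have Dt : coset P t \in D by rewrite mem_gen // !inE eqxx orbT.
have Db : coset P b \in D by rewrite /b morphJ ?(subsetP sNP) //= groupJ.
have cGP : #|G / P| = 8.
  by rewrite card_quotient // -divgS ?normal_sub // cG cP mulnK // expn_gt0 p_gt0.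
have sDG : D \subset G / P by rewrite gen_subG subUset !sub1set !mem_quotient.
(* [D] meets the group [M / P] of order 4 in at least three elements: 1 and the images of [a] and of
   its conjugate [b]. *)
have sMD : M / P \subset D.
  have d4 : (#|D :&: (M / P)| %| 4)%N by rewrite -cMP cardSg ?subsetIr.
  have gt2 : (2 < #|D :&: (M / P)|)%N.
    have <- : #|[set 1; coset P a; coset P b]| = 3.
      rewrite -setUA !cardsU1 cards1 !inE ncab negb_or !(eq_sym 1) !co1 //.
        by apply: (subsetP sMG).
      by apply/negP => /nP2 b1; have := orderJ a t; rewrite -/b b1 ?order1 ?oa //
           -conjXg a2 conj1g.
    apply: subset_leq_card; rewrite !subUset !sub1set !inE.
    by rewrite !group1 Da Db !mem_quotient.
  apply/setIidPr/eqP; rewrite eqEcard subsetIr cMP.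
  by move: d4 gt2; rewrite dvdn_divisors // !inE => /or3P[] /eqP ->.
have nMcD : ~~ (D \subset M / P).
  apply: contra nMt => /subsetP /(_ _ Dt) tMP.
  by rewrite -(quotientGK nPM) mem_morphpre ?(subsetP sNP).
have cD : #|D| = 8.
  have d8 : (#|D| %| 8)%N by rewrite -cGP cardSg.
  have : (4 < #|D|)%N by rewrite -cMP proper_card // properE sMD.
  by move: d8; rewrite dvdn_divisors // !inE => /or4P[] /eqP ->.
have := involutions_gen_dihedral oca oct.
rewrite -/D cD; suff -> : G / P = D.
  by apply; apply: contraNneq nMcD => e; rewrite gen_subG -e setUid sub1set mem_quotient.
by apply/eqP; rewrite eq_sym eqEcard sDG cD cGP.
Qed.
End TwoFactors.

(** * Regular actions over the arcs of a cycle *)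

(** The level [(i, false)] stands for the arc of the [r]-cycle from [i] to [i + 1], and [(i, true)]
    for its reverse; hence the index decreases along backward arcs. *)
Definition cyc_next r (l : 'I_r * bool) :=
  (if l.2 then ord_pred l.1 else ordS l.1, l.2).

Definition cyc_prev r (l : 'I_r * bool) :=
  (if l.2 then ordS l.1 else ord_pred l.1, l.2).

Definition cyc_rev r (l : 'I_r * bool) := (l.1, ~~ l.2).

Lemma cyc_nextK r : cancel (@cyc_next r) (@cyc_prev r).
Proof. by case=> i []; rewrite /cyc_next /cyc_prev /= ?ordSK ?ord_predK. Qed.

Lemma cyc_prevK r : cancel (@cyc_prev r) (@cyc_next r).
Proof. by case=> i []; rewrite /cyc_next /cyc_prev /= ?ordSK ?ord_predK. Qed.

Lemma cyc_revK r : involutive (@cyc_rev r).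
Proof. by case=> i b; rewrite /cyc_rev /= negbK. Qed.

Lemma cyc_rev_prev r (l : 'I_r * bool) :
  cyc_rev (cyc_prev l) = cyc_next (cyc_rev l).
Proof. by case: l => i []. Qed.

Lemma cyc_rev_next r (l : 'I_r * bool) :
  cyc_rev (cyc_next l) = cyc_prev (cyc_rev l).
Proof. by case: l => i []. Qed.

Lemma val_iter_ordS r k (i : 'I_r) : iter k (@ordS r) i = (i + k) %% r :> nat.
Proof.
elim: k => [|k IHk] /=; first by rewrite addn0 modn_small.
by rewrite IHk -addn1 modnDml addn1 addnS.
Qed.

Lemma iter_ordS_id r (i : 'I_r) : iter r (@ordS r) i = i.
Proof. by apply: val_inj; rewrite /= val_iter_ordS modnDr modn_small. Qed.

Lemma iter_cyc_next r k (l : 'I_r * bool) :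
  iter k (@cyc_next r) l = (iter k (if l.2 then @ord_pred r else @ordS r) l.1, l.2).
Proof. by elim: k => [|k IHk] /=; [case: l | rewrite IHk /cyc_next /=; case: l.2]. Qed.

Lemma iter_cyc_next_id r (l : 'I_r * bool) : iter r (@cyc_next r) l = l.
Proof.
have iterK k : cancel (iter k (@ordS r)) (iter k (@ord_pred r)).
  by elim: k => [|k IHk] i //; rewrite iterSr iterS ordSK.
case: l => i b; rewrite iter_cyc_next /=; case: b; rewrite ?iter_ordS_id //.
by rewrite -{1}(iter_ordS_id i) iterK.
Qed.

Lemma cyc_ind r (P : 'I_r * bool -> Prop) (l0 : 'I_r * bool) :
  P l0 -> (forall l, P l -> P (cyc_next l)) -> (forall l, P l -> P (cyc_rev l)) ->
  forall l, P l.
Proof.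
move=> P0 Pn Pr l; have r_gt0 : (0 < r)%N by case: (l.1) => m; apply: leq_trans.
have {P0} Pf : P (l0.1, false).
  by case: l0 P0 => i [] //= /Pr.
suff Pj j : P (j, false) by case: l => j [] //; apply: (Pr (j, false)).
(* The count is congruent to [j - l0.1] modulo [r] and avoids a truncated subtraction. *)
have -> : (j, false) = iter (j + (r - l0.1)) (@cyc_next r) (l0.1, false).
  rewrite iter_cyc_next /=; congr (_, _); apply: val_inj; rewrite /= val_iter_ordS.
  by rewrite addnCA subnKC ?(ltnW (ltn_ord _)) // modnDr modn_small.
by elim: (j + _)%N => //= n; apply: Pn.
Qed.

Lemma iter_ordS_fix r k (i : 'I_r) : iter k (@ordS r) i = i -> (r %| k)%N.
Proof.
move=> /(congr1 val); rewrite /= val_iter_ordS => e.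
have : (i + k == i + 0 %[mod r])%N by rewrite e addn0 modn_small.
by rewrite eqn_modDl mod0n.
Qed.

Lemma cyc_prev_neq r (l : 'I_r * bool) : (1 < r)%N -> cyc_prev l != l.
Proof.
move=> r_gt1; have ns (i : 'I_r) : ordS i != i.
  by apply/eqP => /(@iter_ordS_fix r 1); rewrite dvdn1 => /eqP e; rewrite e in r_gt1.
case: l => i []; rewrite /cyc_prev xpair_eqE eqxx andbT ?ns //=.
by rewrite eq_sym -{1}(ord_predK i) ns.
Qed.

(** * The kernel of the action on levels and its dihedral quotient *)

Section LevelKernel.

Variables (r : nat) (V A : finType) (G : {group {perm V} * {perm A}}).
Variables (rv : A -> A) (lam : A -> 'I_r * bool).
Hypothesis r_gt1 : (1 < r)%N.
Hypothesis regG : forall a b : A,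
  exists! g : {perm V} * {perm A}, g \in G /\ g.2 a = b.
Hypothesis rvG : forall g a, g \in G -> g.2 (rv a) = rv (g.2 a).
Hypothesis lam_rv : forall a, lam (rv a) = cyc_rev (lam a).
Hypothesis lam_surj : forall l, exists a, lam a = l.
Hypothesis lamG : forall g a b, g \in G ->
  lam b = cyc_next (lam a) -> lam (g.2 b) = cyc_next (lam (g.2 a)).

Lemma pair_permM (g h : {perm V} * {perm A}) a : (g * h).2 a = h.2 (g.2 a).
Proof. by rewrite permM. Qed.

Lemma pair_perm1 (a : A) : (1 : {perm V} * {perm A}).2 a = a.
Proof. by rewrite perm1. Qed.

Lemma regular_ex a b : exists2 g, g \in G & g.2 a = b.
Proof. by have [g [[Gg ga] _]] := regG a b; exists g. Qed.

Lemma regular_inj a : {in G &, injective (fun g : {perm V} * {perm A} => g.2 a)}.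
Proof.
move=> g h Gg Gh /= e; have [k [_ uk]] := regG a (h.2 a).
by rewrite -(uk g) // -(uk h).
Qed.

(** [lamG] only compares consecutive levels, so [a] and [b] are both compared with an arc [c] of the
    preceding level. *)
Lemma lamG_eq g a b : g \in G -> lam a = lam b -> lam (g.2 a) = lam (g.2 b).
Proof.
move=> Gg eab; have [c ec] := lam_surj (cyc_prev (lam a)).
rewrite (lamG (a := c) Gg) ?ec ?cyc_prevK //.
by rewrite -(lamG (b := b) Gg) // ec cyc_prevK.
Qed.

Lemma lamG_prev g a b : g \in G ->
  lam b = cyc_prev (lam a) -> lam (g.2 b) = cyc_prev (lam (g.2 a)).
Proof.
by move=> Gg eab; rewrite (lamG (a := b) (b := a) Gg) ?cyc_nextK // eab cyc_prevK.
Qed.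

Lemma lamG_rev g a b : g \in G ->
  lam b = cyc_rev (lam a) -> lam (g.2 b) = cyc_rev (lam (g.2 a)).
Proof.
by move=> Gg eab; rewrite -lam_rv -rvG //; apply: lamG_eq; rewrite ?lam_rv.
Qed.

Definition lev_ker := [set g in G | [forall a, lam (g.2 a) == lam a]].

Lemma lev_kerP g :
  reflect (g \in G /\ forall a, lam (g.2 a) = lam a) (g \in lev_ker).
Proof.
rewrite inE; apply: (iffP andP) => -[Gg H]; split=> //.
  by move=> a; apply/eqP/(forallP H).
by apply/forallP => a; rewrite H.
Qed.

Lemma lev_ker_group_set : group_set lev_ker.
Proof.
apply/group_setP; split; first by apply/lev_kerP; split=> // a; rewrite pair_perm1.
move=> g h /lev_kerP[Gg Hg] /lev_kerP[Gh Hh]; apply/lev_kerP; split.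
  exact: groupM.
by move=> a; rewrite pair_permM Hh Hg.
Qed.
Canonical lev_ker_group := Group lev_ker_group_set.

(** Fixing one level propagates to its successor and to its reverse, hence to all levels by
    [cyc_ind]. *)
Lemma lev_ker1 g a : g \in G -> lam (g.2 a) = lam a -> g \in lev_ker.
Proof.
move=> Gg ga; apply/lev_kerP; split=> // b.
suff : forall l c, lam c = l -> lam (g.2 c) = l by apply.
apply: (@cyc_ind r _ (lam a)) => [c /esym ec|l IHl c ec|l IHl c ec].
- by rewrite -ga; apply: lamG_eq.
- have [d ed] := lam_surj l.
  by rewrite (lamG (a := d) Gg) ?ed // (IHl _ ed).
- have [d ed] := lam_surj l.
  by rewrite (lamG_rev (a := d) Gg) ?ed // (IHl _ ed).
Qed.

Lemma lev_ker_normal : lev_ker <| G.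
Proof.
apply/andP; split; first by apply/subsetP => g /lev_kerP[].
apply/subsetP => g Gg; rewrite inE; apply/subsetP => _ /imsetP[k /lev_kerP[Gk Hk] ->].
apply/lev_kerP; split; first by rewrite groupJ.
move=> a; rewrite conjgE !pair_permM.
rewrite (lamG_eq Gg (Hk _)) -pair_permM mulVg pair_perm1 //.
Qed.

(** For an arc [a] of level [l], the map sending [k] to [k.2 a] is injective by regularity and onto
    the level by [lev_ker1]. *)
Lemma card_lev_ker l : #|lev_ker| = #|[set a | lam a == l]|.
Proof.
have [a ea] := lam_surj l.
have sKG := normal_sub lev_ker_normal.
rewrite -(card_in_imset (sub_in2 (subsetP sKG) (@regular_inj a))).
congr #|pred_of_set _|; apply/setP => b; rewrite inE; apply/imsetP/eqP.
  by case=> k /lev_kerP[_ Hk] ->; rewrite Hk.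
move=> eb; have [g Gg gab] := regular_ex a b.
by exists g => //; apply: (@lev_ker1 g a) => //; rewrite gab eb.
Qed.

Lemma card_regular_levels : #|G| = (2 * r * #|lev_ker|)%N.
Proof.
have [a _] := lam_surj (Ordinal (ltnW r_gt1), false).
rewrite -(card_in_imset (@regular_inj a)).
have -> : [set g.2 a | g : {perm V} * {perm A} in G] = [set: A].
  apply/setP => b; rewrite inE; apply/imsetP.
  by have [g Gg <-] := regular_ex a b; exists g.
rewrite cardsT -[#|A|]sum1_card (partition_big lam xpredT) //=.
rewrite (eq_bigr (fun=> #|lev_ker|)); last first.
  by move=> l _; rewrite (card_lev_ker l) -sum1dep_card.
by rewrite sum_nat_const card_prod card_ord card_bool (mulnC r 2).
Qed.

(* [x] and [y] act on the level of a fixed arc [a] as the reflections [l |-> prev (rev l)]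
   and [l |-> rev l], whose product is a rotation by one step. *)
Lemma lev_quotient_dihedral : G / lev_ker \isog 'D_(2 * r).
Proof.
have nK := normal_norm lev_ker_normal.
have [a _] := lam_surj (Ordinal (ltnW r_gt1), false).
have [y Gy ya] := regular_ex a (rv a).
have [b eb] := lam_surj (cyc_prev (lam (rv a))).
have [x Gx xa] := regular_ex a b.
have lya : lam (y.2 a) = cyc_rev (lam a) by rewrite ya lam_rv.
have lxa : lam (x.2 a) = cyc_prev (cyc_rev (lam a)) by rewrite xa eb lam_rv.
have sqK g : g \in G -> lam (g.2 (g.2 a)) = lam a -> g ^+ 2 \in lev_ker.
  by move=> Gg e; apply: (@lev_ker1 _ a); rewrite ?groupX // expgS expg1 pair_permM.
have y2 : y ^+ 2 \in lev_ker.
  by apply: sqK => //; rewrite (lamG_rev (a := a)) // lya cyc_revK.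
have x2 : x ^+ 2 \in lev_ker.
  apply: sqK => //.
  rewrite (lamG_prev (a := rv a)) //; last by rewrite xa eb.
  by rewrite (lamG_rev (a := a)) ?lam_rv // lxa cyc_rev_prev cyc_revK cyc_nextK.
have nKm g : g \in G -> g \in 'N(lev_ker) by apply: (subsetP nK).
have o2 g : g \in G -> lam (g.2 a) != lam a -> g ^+ 2 \in lev_ker ->
    #[coset lev_ker g] = 2.
  move=> Gg nga g2; apply: order_eq2.
    by apply: contra nga => /eqP /(coset_idr (nKm _ Gg)) /lev_kerP[_ ->].
  by rewrite -morphX ?nKm //= coset_id.
have oy : #[coset lev_ker y] = 2.
  by apply: o2 => //; rewrite lya; case: (lam a) => i []; rewrite xpair_eqE andbF.
have ox : #[coset lev_ker x] = 2.
  by apply: o2 => //; rewrite lxa; case: (lam a) => i []; rewrite xpair_eqE andbF.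
have nxy : coset lev_ker x != coset lev_ker y.
  apply: contraNneq (cyc_prev_neq (lam (rv a)) r_gt1) => exy.
  have : coset lev_ker (x^-1 * y) = 1.
    by rewrite morphM ?groupV ?nKm // morphV ?nKm //= exy mulVg.
  move/(coset_idr (nKm _ (groupM (groupVr Gx) Gy))) => /lev_kerP[_ H].
  have := H (x.2 a); rewrite -pair_permM mulKVg lya lxa => e.
  by rewrite lam_rv -e.
have := involutions_gen_dihedral ox oy nxy.
set D := <<[set coset lev_ker x; coset lev_ker y]>>.
have -> : D = G / lev_ker.
  have -> : D = <<[set x; y]>> / lev_ker.
    rewrite quotient_gen; last by rewrite subUset !sub1set !nKm.
    by rewrite quotientU !quotient_set1 ?nKm.
  apply/eqP; rewrite eqEsubset quotientS; last first.
    by rewrite gen_subG subUset !sub1set Gx.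
  rewrite quotientSK //.
  (* The group generated by [x] and [y] moves [a] to every level. So each [g] in [G] agrees with
     some [h] of it on the level of [a], and then [g * h^-1] lies in the kernel. *)
  have gen l : exists2 h, h \in <<[set x; y]>> & lam (h.2 a) = l.
    have Hx : x \in <<[set x; y]>> by rewrite mem_gen // !inE eqxx.
    have Hy : y \in <<[set x; y]>> by rewrite mem_gen // !inE eqxx orbT.
    have sHG : <<[set x; y]>> \subset G by rewrite gen_subG subUset !sub1set Gx.
    move: l; apply: (@cyc_ind r _ (lam a)).
    - by exists 1; rewrite ?group1 ?pair_perm1.
    (* Products act from left to right: [x * y] takes [a] one level back, so its inverse first
       advances [a] by one level. *)
    - move=> l [h Hh eh]; exists ((x * y)^-1 * h).
        by rewrite groupM ?groupV ?groupM.
      have Gh := subsetP sHG _ Hh.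
      have Gi : (x * y)^-1 \in G by rewrite groupV groupM.
      have xya : lam a = cyc_next (lam ((x * y).2 a)).
        suff -> : lam ((x * y).2 a) = cyc_prev (lam a) by rewrite cyc_prevK.
        rewrite pair_permM (lamG_prev (a := rv a)) //; last by rewrite lxa lam_rv.
        by rewrite (lamG_rev (a := a)) ?lam_rv // lya cyc_revK.
      have := lamG Gi xya; rewrite -pair_permM mulgV pair_perm1 => inv_a.
      by rewrite pair_permM (lamG (a := a) Gh) ?eh.
    - move=> l [h Hh eh]; exists (y * h); first by rewrite groupM.
      have Gh := subsetP sHG _ Hh.
      by rewrite pair_permM (lamG_rev (a := a)) ?eh.
  apply/subsetP => g Gg; have [h Hh eh] := gen (lam (g.2 a)).
  have Gh : h \in G by move: Hh; apply/subsetP; rewrite gen_subG subUset !sub1set Gx.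
  rewrite -(mulgKV h g) mem_mulg //.
  apply: (@lev_ker1 _ a); rewrite ?groupM ?groupV // pair_permM.
  have Gi : h^-1 \in G by rewrite groupV.
  by rewrite -(lamG_eq Gi eh) -pair_permM mulgV pair_perm1.
suff -> : #|G / lev_ker| = (2 * r)%N by [].
rewrite card_quotient // -divgS ?normal_sub ?lev_ker_normal //.
by rewrite card_regular_levels mulnK ?cardG_gt0.
Qed.

End LevelKernel.

(** * Walks and string encodings of arcs *)

Fixpoint stepn (A : Type) (St : A -> A -> Prop) n a b :=
  if n is m.+1 then exists2 c, St a c & stepn St m c b else a = b.

Section Walks.

Variables (r : nat) (V A : finType) (G : {group {perm V} * {perm A}}).
Variables (rv : A -> A) (lam : A -> 'I_r * bool) (St : A -> A -> Prop).
Hypothesis rvG : forall g a, g \in G -> g.2 (rv a) = rv (g.2 a).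
Hypothesis lam_rv : forall a, lam (rv a) = cyc_rev (lam a).
Hypothesis StG : forall g a b, g \in G -> St a b -> St (g.2 a) (g.2 b).
Hypothesis St_lam : forall a b, St a b -> lam b = cyc_next (lam a).

Lemma stepnG n g a b : g \in G -> stepn St n a b -> stepn St n (g.2 a) (g.2 b).
Proof.
move=> Gg; elim: n a => [|n IHn] a /=; first by move->.
by case=> c ac cb; exists (g.2 c); [apply: StG | apply: IHn].
Qed.

Lemma stepn_lam n a b : stepn St n a b -> lam b = iter n (@cyc_next r) (lam a).
Proof.
elim: n a => [|n IHn] a /=; first by move->.
by case=> c /St_lam ac /IHn ->; rewrite ac -iterSr iterS.
Qed.

(** If [b] lies on the level after a forward [a], then so does some [St]-successor [f] of [a], and a
    walk of length divisible by [r] joins [b] to [f]. Automorphisms preserve walks, and each step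
    advances the level by one, so the images of [b] and [f] share a level. Backward arcs follow by
    reversal. *)
Lemma walk_lamG :
  (forall a, (lam a).2 = false -> exists b, St a b) ->
  (forall a b, (lam a).2 = false -> lam a = lam b ->
     exists2 k, (r %| k)%N & stepn St k a b) ->
  forall g a b, g \in G ->
    lam b = cyc_next (lam a) -> lam (g.2 b) = cyc_next (lam (g.2 a)).
Proof.
move=> St_ex around g a b Gg; have fwd c d : (lam c).2 = false ->
    lam d = cyc_next (lam c) -> lam (g.2 d) = cyc_next (lam (g.2 c)).
  move=> fc ed; have [f Sf] := St_ex _ fc; rewrite -(St_lam (StG Gg Sf)).
  have edf : lam d = lam f by rewrite ed (St_lam Sf).
  have fd : (lam d).2 = false by rewrite ed.
  have [_ /dvdnP[q ->] df] := around _ _ fd edf.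
  rewrite (stepn_lam (stepnG Gg df)) iterM.
  by elim: q {df} => //= q <-; rewrite iter_cyc_next_id.
case fa : (lam a).2 => eab; last exact: fwd.
have := fwd (rv b) (rv a); rewrite !lam_rv eab /= fa => /(_ erefl).
rewrite cyc_rev_next cyc_prevK !rvG // !lam_rv => /(_ erefl) e.
apply: (can_inj (@cyc_prevK r)).
by rewrite cyc_nextK -[RHS]cyc_revK e -cyc_rev_prev cyc_revK.
Qed.

End Walks.

Section ArcAction.

Variables V A : finType.

Definition arc_act (a : A) (g : {perm V} * {perm A}) : A := g.2 a.

Lemma arc_act1 a : arc_act a 1 = a.
Proof. by rewrite /arc_act perm1. Qed.

Lemma arc_actM a g h : arc_act a (g * h) = arc_act (arc_act a g) h.
Proof. by rewrite /arc_act permM. Qed.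

Definition arc_action := TotalAction arc_act1 arc_actM.

End ArcAction.

(* Arcs of level [(i, false)] are encoded by strings [x a 0, ..., x a s]: [word i f] is the arc
   with string [f 0, ..., f s], and [St] joins arcs whose strings are consecutive windows. *)
Section StringGraph.

Variables (p s r : nat) (V A : finType) (G : {group {perm V} * {perm A}}).
Variables (rv : A -> A) (lam : A -> 'I_r * bool) (St : A -> A -> Prop).
Variables (x : A -> nat -> 'I_p) (word : 'I_r -> (nat -> 'I_p) -> A).
Hypotheses (p_pr : prime p) (p_odd : odd p) (npr : ~~ (p %| r)%N).
Hypotheses (r_gt1 : (1 < r)%N) (sr : (s < r)%N).
Hypothesis regG : forall a b : A,
  exists! g : {perm V} * {perm A}, g \in G /\ g.2 a = b.
Hypothesis rvG : forall g a, g \in G -> g.2 (rv a) = rv (g.2 a).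
Hypothesis lam_rv : forall a, lam (rv a) = cyc_rev (lam a).
Hypothesis StG : forall g a b, g \in G -> St a b -> St (g.2 a) (g.2 b).
Hypothesis St_lam : forall a b, St a b -> lam b = cyc_next (lam a).
Hypothesis St_x : forall a b j, (lam a).2 = false -> St a b -> (j < s)%N ->
  x b j = x a j.+1.
Hypothesis lam_word : forall i f, lam (word i f) = (i, false).
Hypothesis x_word : forall i f j, (j <= s)%N -> x (word i f) j = f j.
Hypothesis wordE : forall a f, (lam a).2 = false ->
  (forall j, (j <= s)%N -> f j = x a j) -> word (lam a).1 f = a.
Hypothesis St_word : forall i f, St (word i f) (word (ordS i) (f \o succn)).

Lemma stepn_word n i f :
  stepn St n (word i f) (word (iter n (@ordS r) i) (f \o addn n)).
Proof.
elim: n i f => [|n IHn] i f /=.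
  have := @wordE (word i f) (f \o addn 0); rewrite lam_word /= => -> // j js.
  by rewrite x_word.
exists (word (ordS i) (f \o succn)) => //.
have := IHn (ordS i) (f \o succn); rewrite -iterSr iterS.
have := @wordE (word (ordS (iter n (@ordS r) i)) ((f \o succn) \o addn n)) (f \o addn n.+1).
by rewrite lam_word /= => -> // j js; rewrite x_word.
Qed.

Lemma stepn_x n a b j : (lam a).2 = false -> stepn St n a b -> (j + n <= s)%N ->
  x b j = x a (j + n).
Proof.
elim: n a => [|n IHn] a /= fa; first by move->; rewrite addn0.
case=> c ac cb jn; rewrite (IHn c) ?(St_x _ ac) ?addnS //.
- by rewrite -addnS.
- by rewrite (St_lam ac) /cyc_next /= fa.
- by apply: leq_trans jn; rewrite leq_add2l.
Qed.

(* Since [s < r], the strings of [a] and [b] fit without overlap in a walk of length [r]. *)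
Lemma stepn_around a b : (lam a).2 = false -> lam a = lam b -> stepn St r a b.
Proof.
move=> fa eab; pose f j := if (j <= s)%N then x a j else x b (j - r).
have := stepn_word r (lam a).1 f; rewrite iter_ordS_id.
have -> : word (lam a).1 f = a by apply: wordE => // j js; rewrite /f js.
rewrite eab wordE // => [|j js]; first by rewrite -eab.
by rewrite /f /= leqNgt ltn_addr //= addKn.
Qed.

(** This expresses equality of first letters through walks, which automorphisms preserve. *)
Lemma common_ancestor a b : (lam a).2 = false -> lam a = lam b -> x a 0 = x b 0 ->
  exists c, [/\ (lam c).2 = false, stepn St s c a & stepn St s c b].
Proof.
move=> fa eab x0; pose i := iter s (@ord_pred r) (lam a).1.
have iE : iter s (@ordS r) i = (lam a).1.
  rewrite /i; elim: (s) => //= n; rewrite -iterS iterSr => IHn.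
  by rewrite ord_predK.
(* With truncated subtraction the starting string repeats the first letter of [d] in all positions
   up to [s]; it therefore depends on [d] only through [x d 0]. *)
have toE d : (lam d).2 = false -> (lam d).1 = (lam a).1 ->
    stepn St s (word i (fun j => x d (j - s))) d.
  move=> fd ed; have := stepn_word s i (fun j => x d (j - s)).
  rewrite iE -ed wordE //= => j _; by rewrite addKn.
exists (word i (fun j => x a (j - s))); split; rewrite ?lam_word //; first exact: toE.
have {1}-> : word i (fun j => x a (j - s)) = word i (fun j => x b (j - s)).
  have := @wordE (word i (fun j => x b (j - s))) (fun j => x a (j - s)).
  rewrite lam_word /= => -> // j js; rewrite x_word //.
  by have /eqP -> : (j - s == 0)%N.
by apply: toE; rewrite -?eab.
Qed.

Lemma string_lamG g a b : g \in G ->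
  lam b = cyc_next (lam a) -> lam (g.2 b) = cyc_next (lam (g.2 a)).
Proof.
apply: (walk_lamG rvG lam_rv StG St_lam) => [c fc|c d fc ecd].
  by rewrite -(@wordE c (x c)) //; eexists; apply: St_word.
by exists r => //; apply: stepn_around.
Qed.

Lemma string_lam_surj l : exists a, lam a = l.
Proof.
have i0 : 'I_p := Ordinal (prime_gt0 p_pr).
case: l => i []; last by exists (word i (fun=> i0)).
by exists (rv (word i (fun=> i0))); rewrite lam_rv lam_word.
Qed.

Let K := lev_ker_group G lam.

Lemma card_string_ker : #|K| = (p ^ s.+1)%N.
Proof.
have i0 : 'I_r := Ordinal (ltnW r_gt1).
rewrite (card_lev_ker regG rvG lam_rv string_lam_surj string_lamG (i0, false)).
pose enc a : {ffun 'I_s.+1 -> 'I_p} := [ffun j : 'I_s.+1 => x a j].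
transitivity #|[set: {ffun 'I_s.+1 -> 'I_p}]|; last first.
  by rewrite cardsT card_ffun !card_ord.
rewrite -(@card_in_imset _ _ enc) => [|a b].
  congr #|pred_of_set _|; apply/setP => f; rewrite [RHS]inE; apply/imsetP.
  exists (word i0 (f \o inord)); first by rewrite inE lam_word.
  by apply/ffunP => j; rewrite ffunE x_word /= ?inord_val // -ltnS.
rewrite !inE => /eqP la /eqP lb /ffunP e.
rewrite -(@wordE a (x a)) ?la // -(@wordE b (x a)) ?lb // => j js.
by have := e (inord j); rewrite !ffunE inordK.
Qed.

Let to := arc_action V A.

Definition letter_class a := [set b | (lam b == lam a) && (x b 0 == x a 0)].

(** Two arcs of a class end walks of [s] steps from one arc, and so do their images. The last letter
    of the start of such a walk is the first letter of its end. The reverse inclusion comes from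
    [k^-1]. *)
Lemma letter_classK k a : (lam a).2 = false -> k \in K ->
  to^* (letter_class a) k = letter_class (k.2 a).
Proof.
move=> fa /lev_kerP[Gk Hk].
have sub c d : c \in G -> (forall e, lam (c.2 e) = lam e) -> (lam d).2 = false ->
    to^* (letter_class d) c \subset letter_class (c.2 d).
  move=> Gc Hc fd; apply/subsetP => _ /imsetP[b + ->]; rewrite !inE => /andP[/eqP lb /eqP xb].
  rewrite /to /= /arc_act !Hc lb eqxx /=.
  have [e [fe eb ed]] : exists e, [/\ (lam e).2 = false, stepn St s e b & stepn St s e d].
    by apply: common_ancestor; rewrite ?lb.
  have fce : (lam (c.2 e)).2 = false by rewrite Hc.
  by rewrite (stepn_x fce (stepnG StG Gc eb)) // (stepn_x fce (stepnG StG Gc ed)).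
apply/eqP; rewrite eqEsubset sub //.
have Gki : k^-1 \in G by rewrite groupV.
have Hki e : lam (k^-1.2 e) = lam e by rewrite -{2}(pair_perm1 V e) -(mulVg k) pair_permM Hk.
have fka : (lam (k.2 a)).2 = false by rewrite Hk.
have := sub _ _ Gki Hki fka; rewrite -pair_permM mulgV pair_perm1 => /(imsetS (to^~ k)).
by rewrite -!setactE actKV.
Qed.

Lemma Phi_fixes_letter k a : (lam a).2 = false -> k \in 'Phi(K) ->
  x (k.2 a) 0 = x a 0.
Proof.
move=> fa Phik; have sPhi := Phi_sub K; have Kk := subsetP sPhi _ Phik.
have pK : p.-group K by rewrite /pgroup card_string_ker pnatX pnat_id.
have sC : 'C_K[letter_class a | to^*] \subset K := subsetIl _ _.
suff sPC : 'Phi(K) \subset 'C_K[letter_class a | to^*].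
  have := subsetP sPC _ Phik; rewrite inE => /andP[_ /astab1P].
  move/(etrans (esym (letter_classK fa Kk))) => /setP /(_ (k.2 a)); rewrite !inE !eqxx => /esym.
  by case/andP => _ /eqP.
have le_p : (#|orbit to^* K (letter_class a)| <= p)%N.
  pose cls (c : 'I_p) := [set b | (lam b == lam a) && (x b 0 == c)].
  rewrite -[leqRHS](card_ord p) -cardsT; apply: leq_trans (leq_imset_card cls _).
  apply: subset_leq_card; apply/subsetP => _ /orbitP[h Kh <-].
  apply/imsetP; exists (x (h.2 a) 0) => //; apply: etrans (letter_classK fa Kh) _.
  by apply/setP => b; have /lev_kerP[_ Hh] := Kh; rewrite !inE Hh.
have /p_natP[n en] : p.-nat #|K : 'C_K[letter_class a | to^*]|.
  exact: pnat_dvd (dvdn_indexg _ _) pK.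
(* The index of the stabiliser is [p ^ n] and at most [p]: for [n = 0] the stabiliser is [K], and
   for [n = 1] it is maximal and so contains ['Phi(K)]. *)
move: le_p; rewrite card_orbit en; case: n en => [|[|n]] en.
- by move=> _; rewrite (index1g sC en).
- by move=> _; apply: Phi_sub_max; apply: p_index_maximal; rewrite ?en ?expn1.
- by rewrite leqNgt -[ltnLHS]expn1 ltn_exp2l ?(prime_gt1 p_pr).
Qed.

(** The letter of [a] at position [j] is the first letter of an arc [j] steps further on. So
    ['Phi(K)] fixes every letter of [a], hence [a] itself, and is trivial by regularity. *)
Lemma string_ker_abelem : p.-abelem K.
Proof.
have pK : p.-group K by rewrite /pgroup card_string_ker pnatX pnat_id.
rewrite -trivg_Phi // -subG1; apply/subsetP => k Phik; rewrite inE.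
have /lev_kerP[Gk Hk] := subsetP (Phi_sub K) _ Phik.
have i0 : 'I_p := Ordinal (prime_gt0 p_pr).
pose a := word (Ordinal (ltnW r_gt1)) (fun=> i0).
have fa : (lam a).2 = false by rewrite lam_word.
have fka : (lam (k.2 a)).2 = false by rewrite Hk.
suff eka : k.2 a = a.
  by apply/eqP; apply: (regular_inj regG (a := a)); rewrite ?group1 //= eka perm1.
rewrite -{2}(@wordE a (x (k.2 a))) // => [|j js].
  by rewrite -(Hk a) wordE.
have [b ab] : exists b, stepn St j a b by eexists; apply: stepn_word.
rewrite -[j]add0n -(stepn_x fa ab) // -(stepn_x fka (stepnG StG Gk ab)) //.
by rewrite Phi_fixes_letter // (stepn_lam St_lam ab) iter_cyc_next /= fa.
Qed.

Theorem string_graph_semidirect : exists N H : {group {perm V} * {perm A}},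
  [/\ N ><| H = G, N \isog [set: 'rV['Z_p]_(s.+1)] & H \isog 'D_(2 * r)].
Proof.
apply: (@semidirect_of_quotient _ G K p s r) => //.
- exact: (lev_ker_normal string_lam_surj string_lamG).
- exact: string_ker_abelem.
- exact: card_string_ker.
- exact: (lev_quotient_dihedral r_gt1 regG rvG lam_rv string_lam_surj string_lamG).
- exact: (card_regular_levels r_gt1 regG rvG lam_rv string_lam_surj string_lamG).
Qed.

End StringGraph.

(** * Praeger-Xu graphs *)

Definition regular_groups_split (p s r : nat) (X : mgraph) : Prop :=
  forall G : {group (aut_gtype X)}, G \subset GAut X -> arc_regular G ->
    exists (N H : {group (aut_gtype X)}),
      [/\ N ><| H = G, N \isog [set: 'rV['Z_p]_(s.+1)] & H \isog 'D_(2 * r)].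

Section GraphAut.

Variables (X : mgraph) (G : {group (aut_gtype X)}).
Hypothesis sG : G \subset GAut X.

Lemma autG g : g \in G -> forall a,
  [/\ tail (g.2 a) = g.1 (tail a), head (g.2 a) = g.1 (head a)
    & g.2 (rev a) = rev (g.2 a)].
Proof.
move=> Gg a; have := subsetP sG _ Gg; rewrite inE => /forallP /(_ a).
by case/and3P => /eqP-> /eqP-> /eqP->.
Qed.

End GraphAut.

Section SimpleGraph.

Variables (T : finType) (e : rel T).
Notation adj := (symc e).
Notation X := (simple_mgraph adj).

Lemma val_rev (a : arc X) : val (rev a) = (head a, tail a).
Proof. by rewrite val_insubd /= /symc orbC -/(adj _ _) (valP a). Qed.

Lemma adjG (G : {group (aut_gtype X)}) g u v : G \subset GAut X -> g \in G ->
  adj (g.1 u) (g.1 v) = adj u v.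
Proof.
move=> sG.
have imp h w z : h \in G -> adj w z -> adj (h.1 w) (h.1 z).
  move=> Gh wz; pose a : arc X := exist _ (w, z) wz.
  have [] := autG sG Gh a; rewrite /= => <- <- _; exact: (valP (h.2 a)).
move=> Gg; apply/idP/idP; last exact: imp.
move/(imp g^-1); rewrite groupV => /(_ Gg).
by rewrite -!permM -![_ * _]/((g * g^-1).1) mulgV !perm1.
Qed.

End SimpleGraph.

Lemma ordSS_neq r (i : 'I_r) : (2 < r)%N -> ordS (ordS i) != i.
Proof.
move=> r_gt2; apply/eqP => /(@iter_ordS_fix r 2) /dvdn_leq => /(_ isT).
by rewrite leqNgt r_gt2.
Qed.

Lemma multicycle_split p r : prime p -> odd p -> (2 < r)%N -> ~~ (p %| r)%N ->
  regular_groups_split p 0 r (multicycle p r).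
Proof.
move=> p_pr p_odd r_gt2 npr G sG regG.
(* Forbidding a return to the tail of [a] states without reference to levels that [b] continues in
   the direction of [a]; hence automorphisms preserve [St]. *)
pose X := multicycle p r; pose St (a b : arc X) := head a = tail b /\ tail a <> head b.
apply: (@string_graph_semidirect p 0 r _ _ G (@rev X) (fun a => (a.1.1, a.2)) St
  (fun a _ => a.1.2) (fun i f => (i, f 0, false))) => //.
- exact: ltnW.
- exact: ltnW (ltnW r_gt2).
- by move=> g a Gg; have [] := autG sG Gg a.
- move=> g a b Gg [e ne].
  have [ta ha _] := autG sG Gg a; have [tb hb _] := autG sG Gg b.
  split; first exact: etrans ha (etrans (congr1 _ e) (esym tb)).
  by move=> e'; apply: ne; apply: (@perm_inj _ g.1); rewrite -ta e' hb.
- case=> -[i k] [] [[i' k'] []]; rewrite /St /cyc_next /= => -[e ne].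
  + by rewrite e ordSK.
  + by case: ne; rewrite e.
  + by case: ne; apply: ordS_inj.
  + by rewrite e.
- by move=> i f [].
- by case=> -[i k] b f /= -> -> .
- by move=> i f; split=> //= /esym/eqP; apply/negP/ordSS_neq.
Qed.

(** * Levels and letters of the arcs of [C(p,r,s)] with [s = n.+1] *)

Section PraegerXu.

Variables (p r n : nat).
Hypotheses (p_pr : prime p) (p_odd : odd p) (r_gt2 : (2 < r)%N).
Notation V := (px_vert p r n.+1).
Notation e := (@px_e p r n.+1).
Notation adj := (symc e).

(** The two windows of the string overlap in [n] letters; conversely, the letters of [u] followed by
    the last letter of [v] form a suitable string. *)
Lemma px_eP (u v : V) :
  reflect (v.1 = ordS u.1 /\ forall j, (j < n)%N -> v.2 (inord j) = u.2 (inord j.+1)) (e u v).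
Proof.
apply: (iffP existsP) => [[x /and3P[/eqP eu /eqP -> /eqP ev]]|[ev H]].
  split=> // j jn; rewrite eu ev !ffunE; congr (x _); apply: val_inj.
  by rewrite /= /bump /= !inordK // ltnS ltnW.
exists [ffun k : 'I_n.+2 => if (k <= n)%N then u.2 (inord k) else v.2 ord_max].
rewrite ev eqxx /=; apply/andP; split; apply/eqP/ffunP => j; rewrite !ffunE /=.
  by rewrite -ltnS ltn_ord inord_val.
rewrite /bump /= add1n; have [jn|jn] := ltnP j n; first by rewrite -H // inord_val.
by congr (v.2 _); apply: val_inj => /=; apply/eqP; rewrite eqn_leq jn -ltnS ltn_ord.
Qed.

Lemma px_e_level (u v : V) : e u v -> v.1 = ordS u.1.
Proof. by case/px_eP. Qed.

(** As [r > 2], an edge cannot advance the index in both directions, which makes [px_lev] well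
    behaved under reversal. *)
Lemma px_e_asym (u v : V) : e u v -> v.1 = ordS u.1 /\ u.1 <> ordS v.1.
Proof.
by move=> /px_e_level ->; split=> // /esym /eqP; apply/negP/ordSS_neq.
Qed.

Definition px_word (i : 'I_r) (f : nat -> 'I_p) : V := (i, [ffun j : 'I_n.+1 => f j]).

Lemma px_word_e i f : e (px_word i f) (px_word (ordS i) (f \o succn)).
Proof.
apply/px_eP; split=> // j jn.
by rewrite !ffunE /= !inordK // ltnS ltnW.
Qed.

Lemma px_word_adj i f : adj (px_word i f) (px_word (ordS i) (f \o succn)).
Proof. by rewrite /symc px_word_e. Qed.

Notation X := (PX p r n.+1).

Definition px_lev (a : arc X) : 'I_r * bool :=
  let: (u, v) := val a in if v.1 == ordS u.1 then (u.1, false) else (v.1, true).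

Lemma px_lev_cases (a : arc X) :
  (e (tail a) (head a) /\ px_lev a = ((tail a).1, false)) \/
  (e (head a) (tail a) /\ px_lev a = ((head a).1, true)).
Proof.
case: a => -[u v] /= uv; case/orP: (uv) => /=.
  by move=> h; left; rewrite /px_lev /= (px_e_level h) eqxx.
move=> h; right; split=> //; rewrite /px_lev /=.
by case: eqP => // h'; case: (px_e_asym h).
Qed.

Lemma px_lev_rev (a : arc X) : px_lev (rev a) = cyc_rev (px_lev a).
Proof.
have [[h hl]|[h hl]] := px_lev_cases a; rewrite hl /px_lev val_rev.
  by case: eqP => // h'; case: (px_e_asym h).
by rewrite (px_e_level h) eqxx.
Qed.

(** A forward arc carries the whole string of [n.+2] letters: all but the last are those of its
    tail, and the head adds the last one. *)
Definition px_letter (a : arc X) (j : nat) :=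
  if (j <= n)%N then (tail a).2 (inord j) else (head a).2 ord_max.

(* [sep u w] is to tell, for two neighbours of a vertex [v], whether they lie on
   different sides of [v]. *)
Lemma px_split_of_sep (sep : rel V) : (n.+1 < r)%N -> ~~ (p %| r)%N ->
  (forall u v w, e u v -> e v w -> sep u w) ->
  (forall u v w, e u v -> e w v -> ~~ sep u w) ->
  (forall u v w, e v u -> e v w -> ~~ sep u w) ->
  (forall (h : {perm V}) u w, (forall y z, adj (h y) (h z) = adj y z) ->
     sep u w -> sep (h u) (h w)) ->
  regular_groups_split p n.+1 r X.
Proof.
move=> nr npr sep_fwd sep_out sep_in sep_aut G sG regG.
pose St (a b : arc X) := head a = tail b /\ sep (tail a) (head b).
pose word i f : arc X := exist _ (_, _) (px_word_adj i f).
apply: (@string_graph_semidirect p n.+1 r _ _ G (@rev X) px_lev St px_letter word) => //.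
- exact: ltnW.
- by move=> g a Gg; have [] := autG sG Gg a.
- exact: px_lev_rev.
- move=> g a b Gg [h sp].
  have [ta ha _] := autG sG Gg a; have [tb hb _] := autG sG Gg b.
  split; first exact: etrans ha (etrans (congr1 _ h) (esym tb)).
  rewrite ta hb; apply: sep_aut sp => y z; exact: (adjG _ _ sG Gg).
- move=> a b [h sp].
  (* If [a] and [b] had opposite directions, [tail a] and [head b] would lie on the same side of the
     vertex between them, against [sep]. *)
  have [[ea ->]|[ea ->]] := px_lev_cases a; have [[eb ->]|[eb ->]] := px_lev_cases b.
  + by rewrite -h (px_e_level ea).
  + by rewrite -h in eb; rewrite (negPf (sep_out _ _ _ ea eb)) in sp.
  + by rewrite -h in eb; rewrite (negPf (sep_in _ _ _ ea eb)) in sp.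
  + by rewrite -h in eb; rewrite (px_e_level eb) /cyc_next /= ordSK.
- move=> a b j fa [h sp] jn; rewrite /px_letter -ltnS jn -h.
  have [[/px_eP[_ ea] _]|[_ ea]] := px_lev_cases a; last by rewrite ea in fa.
  case: ltnP => [lt|ge]; first by rewrite ea.
  congr ((head a).2 _); apply: val_inj; rewrite /= inordK //.
  by apply/eqP; rewrite eqn_leq ge -ltnS jn.
- by move=> i f; rewrite /px_lev /= eqxx.
- move=> i f j; rewrite /px_letter leq_eqVlt ltnS => /orP[/eqP->|jn].
    by rewrite ltnn ffunE.
  by rewrite jn ffunE inordK.
- move=> a f fa H; apply: val_inj; rewrite /=.
  have [[/px_eP[la ea] l]|[_ l]] := px_lev_cases a; last by rewrite l in fa.
  rewrite l /= [RHS]surjective_pairing; congr (_, _).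
    rewrite [RHS]surjective_pairing; congr (_, _); apply/ffunP => j.
    rewrite ffunE H ?(ltnW (ltn_ord j)) //.
    by rewrite /px_letter -ltnS ltn_ord inord_val.
  rewrite [RHS]surjective_pairing -/(head a) la; congr (_, _); apply/ffunP => j.
  rewrite ffunE /= H // /px_letter; case: ltnP => [jn|jn]; first by rewrite -ea // inord_val.
  by congr ((head a).2 _); apply: val_inj => /=; apply/eqP; rewrite eqn_leq jn -ltnS ltn_ord.
- by move=> i f; split=> //=; apply: sep_fwd; apply: px_word_e.
Qed.

Lemma leq_common_card (u w : V) (F : 'I_p -> V) : injective F ->
  (forall c, adj u (F c) && adj w (F c)) ->
  (p <= #|[set z | adj u z && adj w z]|)%N.
Proof.
move=> injF H; rewrite -[leqLHS](card_ord p) -cardsT -(card_imset _ injF).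
by apply: subset_leq_card; apply/subsetP => _ /imsetP[c _ ->]; rewrite inE.
Qed.

(** The vertex [u] determines all letters of [z] except the last, which for [n > 0] is still visible
    in [w] at position [n.-1]. *)
Lemma px_mid_uniq u w z z' : (0 < n)%N ->
  e u z -> e z w -> e u z' -> e z' w -> z = z'.
Proof.
move=> n_gt0 /px_eP[uz1 uz] /px_eP[zw1 zw] /px_eP[uz'1 uz'] /px_eP[_ z'w].
rewrite [LHS]surjective_pairing [RHS]surjective_pairing uz1 uz'1; congr (_, _).
apply/ffunP => j; rewrite -(inord_val j).
have [jn|jn] := ltnP j n; first by rewrite uz // uz'.
have -> : (j : nat) = n.-1.+1.
  by rewrite prednK //; apply/eqP; rewrite eqn_leq jn -ltnS ltn_ord.
by rewrite -zw ?ltn_predL // -z'w ?ltn_predL.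
Qed.

(* Two neighbours of [v] on the same side of it have at least [p > 2] common neighbours, while
   two neighbours on different sides have at most two (two only if [r = 4]). *)
Lemma px_split_ge2 : (0 < n)%N -> (n.+1 < r)%N -> ~~ (p %| r)%N ->
  regular_groups_split p n.+1 r X.
Proof.
move=> n_gt0 nr npr.
have p_gt2 : (2 < p)%N by case: p p_pr p_odd => [|[|[]]].
pose common (u w : V) := [set z | adj u z && adj w z].
apply: (@px_split_of_sep (fun u w => (#|common u w| <= 2)%N)) => //.
- move=> u v w uv vw.
  (* A common neighbour is the middle of a directed path from [u] to [w] if it has the index of [v],
     and otherwise of one from [w] to [u]. Each kind contains at most one vertex. *)
  have inj : {in common u w &, injective (fun z : V => z.1 == v.1)}.
    have side z : z \in common u w ->
      if z.1 == v.1 then e u z /\ e z w else e w z /\ e z u.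
      rewrite inE => /andP[uz wz]; case: eqP => zv.
        split.
          case/orP: uz => // /px_e_level h; case/eqP: (ordSS_neq u.1 r_gt2).
          by rewrite {2}h zv (px_e_level uv).
        case/orP: wz => // /px_e_level h; case/eqP: (ordSS_neq v.1 r_gt2).
        by rewrite -{2}zv h (px_e_level vw).
      split.
        case/orP: wz => // /px_e_level h; case: zv; apply: ordS_inj.
        by rewrite -h (px_e_level vw).
      case/orP: uz => // /px_e_level h; case: zv.
      by rewrite h (px_e_level uv).
    move=> z z' /side sz /side sz' h; move: sz sz'; rewrite h.
    by case: ifP => _ [? ?] [? ?]; apply: px_mid_uniq n_gt0 _ _ _ _; eassumption.
  by rewrite -(card_in_imset inj) -card_bool max_card.
- move=> u v w uv wv; rewrite -ltnNge; apply: leq_trans p_gt2 _.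
  (* Predecessors of [v] do not constrain its last letter, so changing it gives [p] common
     neighbours. *)
  pose F c : V := (v.1, [ffun j : 'I_n.+1 => if (j < n)%N then v.2 j else c]).
  apply: (@leq_common_card u w F) => [c c' [/ffunP /(_ ord_max)]|c].
    by rewrite !ffunE ltnn.
  have h y : e y v -> adj y (F c).
    case/px_eP => h1 h2; apply/orP; left; apply/px_eP; split=> // j jn.
    by rewrite ffunE inordK ?jn ?h2 // ltnS ltnW.
  by rewrite !h.
- move=> u v w vu vw; rewrite -ltnNge; apply: leq_trans p_gt2 _.
  (* Dually, successors of [v] do not constrain its first letter. *)
  pose F c : V := (v.1, [ffun j : 'I_n.+1 => if j == ord0 then c else v.2 j]).
  apply: (@leq_common_card u w F) => [c c' [/ffunP /(_ ord0)]|c].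
    by rewrite !ffunE eqxx.
  have h y : e v y -> adj y (F c).
    case/px_eP => h1 h2; apply/orP; right; apply/px_eP; split=> // j jn.
    by rewrite ffunE -val_eqE /= inordK //= h2.
  by rewrite !h.
- move=> h u w hA; rewrite -(card_imset _ (@perm_inj _ h)); apply: leq_trans.
  apply: subset_leq_card; apply/subsetP => z; rewrite inE => hz.
  by apply/imsetP; exists (h^-1 z); rewrite ?permKV // inE -(hA u) -(hA w) permKV.
Qed.

End PraegerXu.

(** For [s = 1] the windows do not overlap: the graph is the [r]-cycle with each vertex replaced by
    [p] independent ones. *)
Lemma px1_e p r (u v : px_vert p r 1) : px_e u v = (v.1 == ordS u.1).
Proof. by apply/px_eP/eqP => [[]|]. Qed.

(** Here the sides of a vertex are told apart by entire neighbourhoods: vertices of equal index are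
    twins, while those with indices [i] and [i + 2] are not, as [r] is not 4. *)
Lemma px_split_1 p r : prime p -> odd p -> (2 < r)%N -> r <> 4 -> ~~ (p %| r)%N ->
  regular_groups_split p 1 r (PX p r 1).
Proof.
move=> p_pr p_odd r_gt2 r_n4 npr.
pose sep (u w : px_vert p r 1) :=
  [exists z, symc (@px_e p r 1) u z != symc (@px_e p r 1) w z].
have twin u w : u.1 = w.1 -> ~~ sep u w.
  by move=> h; apply/existsPn => z; rewrite /symc !px1_e h eqxx.
apply: (@px_split_of_sep p r 0 p_pr p_odd r_gt2 sep) => //.
- exact: ltnW.
- move=> u v w; rewrite !px1_e => /eqP uv /eqP vw.
  (* This vertex, of index [u.1 - 1], is adjacent to [u]; adjacency to [w], of index [u.1 + 2],
     would force [r] to divide 4 or 2. *)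
  apply/existsP; exists (ord_pred u.1, u.2); rewrite /symc !px1_e /= ord_predK eqxx orbT.
  rewrite vw uv negb_or; apply/andP; split; last exact: ordSS_neq.
  apply/eqP => h; have /(@iter_ordS_fix r 4) : iter 4 (@ordS r) u.1 = u.1.
    by rewrite /= -h ord_predK.
  rewrite dvdn_divisors // !inE => /or3P[] /eqP h'; move: r_gt2 r_n4; rewrite h' //.
- by move=> u v w; rewrite !px1_e => /eqP uv /eqP wv; apply/twin/ordS_inj; rewrite -uv.
- by move=> u v w; rewrite !px1_e => /eqP uv /eqP wv; apply: twin; rewrite uv.
- move=> h u w hA /existsP[z hz]; apply/existsP; exists (h z).
  by rewrite !hA.
Qed.

(** * Cycles and complete bipartite graphs *)

Section Cycle.

Variables (p r : nat).
Hypotheses (p_pr : prime p) (p_odd : odd p) (r_gt2 : (2 < r)%N) (npr : ~~ (p %| r)%N).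
Notation m := (p * r)%N.
Notation X := (cycle_graph m).

Let r_gt0 : (0 < r)%N := ltnW (ltnW r_gt2).

Let m_gt2 : (2 < m)%N.
Proof. by apply: leq_trans r_gt2 _; rewrite leq_pmull ?prime_gt0. Qed.

(** Reduction modulo [r] makes the cycle of length [p * r] a [p]-fold cover of the [r]-cycle, which
    supplies levels of [p] arcs each. *)
Definition mod_ord (u : 'I_m) : 'I_r := Ordinal (ltn_pmod u r_gt0).

Lemma mod_ordS u : mod_ord (ordS u) = ordS (mod_ord u).
Proof.
by apply: val_inj; rewrite /= modn_dvdm ?dvdn_mull // -[in RHS]addn1 modnDml addn1.
Qed.

Definition cycle_lev (a : arc X) : 'I_r * bool :=
  let: (u, v) := val a in
  if v == ordS u then (mod_ord u, false) else (mod_ord v, true).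

Lemma cycle_lev_cases (a : arc X) :
  (head a = ordS (tail a) /\ cycle_lev a = (mod_ord (tail a), false)) \/
  (tail a = ordS (head a) /\ cycle_lev a = (mod_ord (head a), true)).
Proof.
case: a => -[u v] /= uv; rewrite /cycle_lev /=; case: eqP => h; first by left.
by right; case/orP: uv => /eqP.
Qed.

Lemma fwd_adj (u : 'I_m) : symc (fun u v : 'I_m => v == ordS u) u (ordS u).
Proof. by rewrite /symc eqxx. Qed.

Definition fwd_arc u : arc X := exist _ (u, ordS u) (fwd_adj u).

Lemma lev_fwd_arc u : cycle_lev (fwd_arc u) = (mod_ord u, false).
Proof. by rewrite /cycle_lev /= eqxx. Qed.

Lemma fwd_arcE (a : arc X) : (cycle_lev a).2 = false -> a = fwd_arc (tail a).
Proof.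
have [[h l]|[h l]] := cycle_lev_cases a; rewrite l // => _.
by apply: val_inj; rewrite /= -h [LHS]surjective_pairing.
Qed.

(** An arc has only one [St]-successor here, so its next letter is not free and the string encoding
    is replaced by [walk_lamG]. The kernel has prime order [p], hence is elementary abelian. *)
Lemma cycle_split : regular_groups_split p 0 r X.
Proof.
move=> G sG regG.
pose St (a b : arc X) := head a = tail b /\ tail a <> head b.
have rvG g (a : arc X) : g \in G -> g.2 (rev a) = rev (g.2 a).
  by move=> Gg; have [] := autG sG Gg a.
have lev_rev (a : arc X) : cycle_lev (rev a) = cyc_rev (cycle_lev a).
  have [[h l]|[h l]] := cycle_lev_cases a; rewrite l /cycle_lev val_rev h ?eqxx //.
  by rewrite eq_sym (negPf (ordSS_neq _ m_gt2)).
have StG g (a b : arc X) : g \in G -> St a b -> St (g.2 a) (g.2 b).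
  move=> Gg [e ne].
  have [ta ha _] := autG sG Gg a; have [tb hb _] := autG sG Gg b.
  split; first exact: etrans ha (etrans (congr1 _ e) (esym tb)).
  by move=> e'; apply: ne; apply: (@perm_inj _ g.1); rewrite -ta e' hb.
have St_lev (a b : arc X) : St a b -> cycle_lev b = cyc_next (cycle_lev a).
  case=> h h'; have [[ea ->]|[ea ->]] := cycle_lev_cases a;
  have [[eb ->]|[eb ->]] := cycle_lev_cases b.
  - by rewrite -h ea mod_ordS.
  - by case: h'; apply: ordS_inj; rewrite -ea h.
  - by case: h'; rewrite ea eb h.
  - by rewrite h eb mod_ordS /cyc_next /= ordSK.
have St_fwd u : St (fwd_arc u) (fwd_arc (ordS u)).
  by split=> //= /esym/eqP; apply/negP/ordSS_neq.
have stepn_fwd k u : stepn St k (fwd_arc u) (fwd_arc (iter k (@ordS m) u)).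
  elim: k u => [|k IHk] u //=; exists (fwd_arc (ordS u)) => //.
  by rewrite -iterS iterSr; apply: IHk.
have levG : forall g (a b : arc X), g \in G ->
    cycle_lev b = cyc_next (cycle_lev a) ->
    cycle_lev (g.2 b) = cyc_next (cycle_lev (g.2 a)).
  apply: (walk_lamG rvG lev_rev StG St_lev) => [a fa|a b fa eab].
    by rewrite (fwd_arcE fa); eexists; apply: St_fwd.
  have fb : (cycle_lev b).2 = false by rewrite -eab.
  (* Walk from [tail a] up to 0, then on to [tail b]. As the tails agree modulo [r] and [r] divides
     [m], so does [r] this length. *)
  exists ((m - tail a) + tail b)%N.
    have : mod_ord (tail a) = mod_ord (tail b).
      move: eab; rewrite {1}(fwd_arcE fa) {1}(fwd_arcE fb) !lev_fwd_arc.
      by case=> h; apply: val_inj.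
    move=> /(congr1 val) /= h; rewrite /dvdn -modnDmr -h modnDmr subnK ?(ltnW (ltn_ord _)) //.
    by rewrite modnMl.
  have := stepn_fwd ((m - tail a) + tail b)%N (tail a); rewrite -(fwd_arcE fa).
  suff -> : iter (m - tail a + tail b) (@ordS m) (tail a) = tail b by rewrite -(fwd_arcE fb).
  apply: val_inj; rewrite /= val_iter_ordS addnA subnKC ?(ltnW (ltn_ord _)) //.
  by rewrite modnDl modn_small.
have ex_lev l : exists a, cycle_lev a = l.
  have ex_fwd i : exists a, cycle_lev a = (i, false).
    have im : (i < m)%N by apply: leq_trans (ltn_ord i) _; rewrite leq_pmull ?prime_gt0.
    exists (fwd_arc (Ordinal im)); rewrite lev_fwd_arc; congr (_, _).
    by apply: val_inj; rewrite /= modn_small.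
  case: l => i b; have [a ea] := ex_fwd i.
  by case: b; [exists (rev a); rewrite lev_rev ea | exists a].
have r_gt1 := ltnW r_gt2.
have cK : #|lev_ker G cycle_lev| = p.
  rewrite (card_lev_ker regG rvG lev_rev ex_lev levG (Ordinal r_gt0, false)).
  have km (k : 'I_p) : (k * r < m)%N by rewrite ltn_pmul2r.
  rewrite -[RHS](card_ord p) -cardsT.
  have injF : injective (fun k => fwd_arc (Ordinal (km k))).
    move=> k k' /(congr1 val) [/eqP]; rewrite eqn_pmul2r // => /eqP h _.
    exact: val_inj.
  rewrite -(card_imset _ injF); congr #|pred_of_set _|; apply/setP => a; rewrite inE.
  apply/eqP/imsetP => [la|[k _ ->]].
    have fa : (cycle_lev a).2 = false by rewrite la.
    have dv : (tail a %/ r < p)%N by rewrite ltn_divLR.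
    exists (Ordinal dv) => //; rewrite [LHS](fwd_arcE fa); congr fwd_arc.
    apply: val_inj => /=; move: la; rewrite {1}(fwd_arcE fa) lev_fwd_arc => -[h].
    by rewrite divnK // /dvdn h.
  by rewrite lev_fwd_arc; congr (_, _); apply: val_inj; rewrite /= modnMl.
apply: (@semidirect_of_quotient _ G (lev_ker_group G cycle_lev) p 0 r) => //.
- exact: (lev_ker_normal ex_lev levG).
- exact: (prime_abelem p_pr cK).
- exact: (lev_quotient_dihedral r_gt1 regG rvG lev_rev ex_lev levG).
- exact: (card_regular_levels r_gt1 regG rvG lev_rev ex_lev levG).
Qed.

End Cycle.

(** * The exceptional graph [C(p,4,1)], the complete bipartite graph on [2 * p] plus [2 * p]
    vertices *)

Section CompleteBipartite.

Variables (p : nat).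
Hypotheses (p_pr : prime p) (p_odd : odd p).
Notation V := (px_vert p 4 1).
Notation X := (PX p 4 1).
Notation adj := (symc (@px_e p 4 1)).

(** Modulo 4, two indices differ by one in either direction exactly when their parities differ. *)
Lemma px41_adj (u v : V) : adj u v = (odd u.1 != odd v.1).
Proof.
rewrite /symc !px1_e; case: u v => [i f] [j g] /=.
by case: i => -[|[|[|[|]]]] //= ?; case: j => -[|[|[|[|]]]] //= ?.
Qed.

Lemma card_side b : #|[set v : V | odd v.1 == b]| = (2 * p)%N.
Proof.
have -> : [set v : V | odd v.1 == b] = setX [set i : 'I_4 | odd i == b] setT.
  by apply/setP => v; rewrite !inE andbT.
rewrite cardsX cardsT card_ffun !card_ord expn1; congr (_ * _)%N.
by rewrite -sum1dep_card big_mkcond !big_ord_recl big_ord0; case: b.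
Qed.

Definition vert_act (v : V) (g : aut_gtype X) : V := g.1 v.

Lemma vert_act1 v : vert_act v 1 = v.
Proof. by rewrite /vert_act perm1. Qed.

Lemma vert_actM v g h : vert_act v (g * h) = vert_act (vert_act v g) h.
Proof. by rewrite /vert_act permM. Qed.

Definition vert_action := TotalAction vert_act1 vert_actM.

Lemma px41_split : regular_groups_split p 1 4 X.
Proof.
move=> G sG regG; pose to := vert_action.
have z : 'I_p := Ordinal (prime_gt0 p_pr).
pose u : V := (inord 0, [ffun=> z]); pose w : V := (inord 1, [ffun=> z]).
have ou : odd u.1 = false by rewrite /= inordK.
have ow : odd w.1 = true by rewrite /= inordK.
have uw : adj u w by rewrite px41_adj ou ow.
pose a : arc X := exist _ (u, w) uw.
(* An arc of a simple graph is determined by its ends, so regularity on arcs makes an element of [G]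
   determined by the images of [u] and [w]. *)
have regE g h : g \in G -> h \in G -> g.1 u = h.1 u -> g.1 w = h.1 w -> g = h.
  move=> Gg Gh eu ew; apply: (regular_inj regG (a := a)) => //.
  have [tg hg _] := autG sG Gg a; have [th hh _] := autG sG Gh a.
  apply: val_inj; rewrite [LHS]surjective_pairing [RHS]surjective_pairing.
  by congr (_, _); [rewrite [LHS]tg [RHS]th | rewrite [LHS]hg [RHS]hh].
have regX v y : adj v y -> exists2 g, g \in G & g.1 u = v /\ g.1 w = y.
  move=> vy; have [g Gg ga] := regular_ex regG a (exist _ (v, y) vy : arc X).
  exists g => //; have [tg hg _] := autG sG Gg a.
  by split; [rewrite -[LHS]/(g.1 (tail a)) -tg ga | rewrite -[LHS]/(g.1 (head a)) -hg ga].
have parG g (v y : V) : g \in G -> odd v.1 = odd y.1 -> odd (g.1 v).1 = odd (g.1 y).1.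
  move=> Gg e; apply/eqP; rewrite -[_ == _]negbK -px41_adj (adjG _ _ sG Gg) px41_adj.
  by rewrite e eqxx.
pose M := [set g in G | odd (g.1 u).1 == false].
(* Testing the side of [u] alone suffices, since automorphisms preserve the bipartition. *)
have MP g : reflect (g \in G /\ forall v : V, odd (g.1 v).1 = odd v.1) (g \in M).
  rewrite inE; apply: (iffP andP) => -[Gg h]; split=> //; last by rewrite h ou.
  move=> v; case ov: (odd v.1); last by rewrite (parG g v u) ?ou ?(eqP h).
  have := adjG u v sG Gg; rewrite !px41_adj (eqP h) ou ov.
  by case: (odd _).
have gM : group_set M.
  apply/group_setP; split; first by apply/MP; split=> // v; rewrite perm1.
  move=> g h /MP[Gg Hg] /MP[Gh Hh]; apply/MP; split; first exact: groupM.
  by move=> v; rewrite permM Hh Hg.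
pose MG := Group gM; pose A := 'C_G[u | to]%G; pose B := 'C_G[w | to]%G.
have AP g : g \in A -> g \in G /\ g.1 u = u by case/setIP=> Gg /astab1P.
have BP g : g \in B -> g \in G /\ g.1 w = w by case/setIP=> Gg /astab1P.
have sMG : MG \subset G by apply/subsetP => g /MP[].
have sAM : A \subset MG.
  by apply/subsetP => g /AP[Gg gu]; rewrite inE Gg gu ou.
have sBM : B \subset MG.
  apply/subsetP => g /BP[Gg gw]; rewrite inE Gg.
  have := adjG u w sG Gg; rewrite !px41_adj gw ou ow.
  by case: (odd _).
have tiAB : A :&: B = 1.
  apply/trivgP/subsetP => g /setIP[/AP[Gg gu] /BP[_ gw]]; rewrite inE.
  by apply/eqP/regE; rewrite ?perm1.
(* By arc-regularity [A] acts regularly on the neighbours of [u], which are the vertices of odd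
   index. *)
have cA : #|A| = (2 * p)%N.
  rewrite -(card_side true) -(@card_in_imset _ _ (fun g : aut_gtype X => g.1 w)).
    congr #|pred_of_set _|; apply/setP => v; rewrite inE; apply/imsetP/eqP.
      by case=> g /(subsetP sAM) /MP[_ Hg] ->; rewrite Hg ow.
    move=> ov; have [|g Gg [gu gw]] := regX u v; first by rewrite px41_adj ou ov.
    by exists g => //; apply/setIP; split=> //; apply/astab1P.
  by move=> g h /AP[Gg gu] /AP[Gh hu] e; apply: regE; rewrite // gu hu.
have toward (v : V) : exists2 g, g \in G & g.1 u = v.
  pose y : V := if odd v.1 then u else w.
  have [|g Gg [gu _]] := regX v y; last by exists g.
  by rewrite px41_adj /y; case: ifP => _; rewrite ?ou ?ow.
have cG : #|G| = (8 * p ^ 2)%N.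
  rewrite -(card_orbit_stab to G u) -/A cA.
  have -> : orbit to G u = setT.
    by apply/setP => v; rewrite inE; have [g Gg <-] := toward v; apply: mem_orbit.
  rewrite cardsT card_prod card_ffun !card_ord expn1 mulnACA.
  by rewrite mulnn.
have cM : #|MG| = (4 * p ^ 2)%N.
  rewrite -(card_orbit_stab to MG u).
  have -> : 'C_MG[u | to] = A.
    apply/setP => g; apply/setIP/setIP => -[Hg Cg]; split=> //; first by case/MP: Hg.
    by move/astab1P: (Cg) => gu; rewrite inE Hg [g.1 u]gu ou.
  have -> : orbit to MG u = [set v : V | odd v.1 == false].
    apply/setP => v; rewrite inE; apply/orbitP/eqP => [[g /MP[_ Hg] <-]|ov].
      by rewrite /= /vert_act Hg.
    have [g Gg gu] := toward v; exists g => //; by rewrite inE Gg gu ov.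
  by rewrite card_side cA mulnACA mulnn.
(* [t] reverses the arc [a]: its square fixes [a] and so is 1, and conjugation by [t] exchanges the
   stabilisers of the two ends. *)
have [|t Gt [tu tw]] := regX w u; first by rewrite px41_adj ou ow.
have t2 : t ^+ 2 = 1.
  apply: regE; rewrite ?groupX //.
    by rewrite expgS expg1 -[LHS]/((t.1 * t.1) u) permM tu tw perm1.
  by rewrite expgS expg1 -[LHS]/((t.1 * t.1) w) permM tw tu perm1.
have nMt : t \notin MG by apply/negP => /MP[_ /(_ u)]; rewrite tu ou ow.
have AtB : A :^ t = B.
  by rewrite conjIg conjGid // -(astab1_act to) /= /vert_act tu.
have cB : #|B| = (2 * p)%N by rewrite -AtB cardJg.
have [K [nKG abK cK isoK]] :=
  two_factors_dihedral p_pr p_odd sAM sBM sMG cA cB tiAB cM cG Gt t2 nMt AtB.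
apply: (@semidirect_of_quotient _ G K p 1 4) => //; last by rewrite cG cK.
rewrite (Euclid_dvdX 2 2) // andbT dvdn_prime2 //.
by apply: contraTneq p_odd => ->.
Qed.

End CompleteBipartite.

Theorem theorem4p2 (p s r : nat) (delta : int) :
  prime p -> odd p -> (delta == 1%R) || (delta == (-1)%R) ->
  (3 <= r)%N -> (s.+1 <= r)%N -> ~~ (p %| r)%N ->
  forall G : {group (aut_gtype (PXstar p r s delta))},
    G \subset GAut (PXstar p r s delta) ->
    arc_regular G ->
    exists (N H : {group (aut_gtype (PXstar p r s delta))}),
      [/\ N ><| H = G,
          N \isog [set: 'rV['Z_p]_(s.+1)] &
          H \isog 'D_(2 * r)].
Proof.
move=> p_pr p_odd _ r_gt2 sr npr.
change (regular_groups_split p s r (PXstar p r s delta)).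
(* The ways to recognise levels differ: no backtracking for [s = 0], twins for [s = 1] with [r] not
   4, and common neighbours for [s >= 2]. *)
rewrite /PXstar; case: s sr => [|[|n]] sr /=.
- by case: ifP => _; [apply: multicycle_split | apply: cycle_split].
- have [r4|/eqP r4] := eqVneq r 4; last exact: px_split_1.
  by rewrite r4; apply: px41_split.
- exact: px_split_ge2.
Qed.
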